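(* Let $a<b$ be real numbers and let $\alpha\in(0,1)$. Let $u:[a,b]\to\mathbb{R}$ be a convex and integrable function. If $w:[a,b]\to\mathbb{R}$ is nonnegative, integrable and symmetric with respect to $\frac{a+b}{2}$, that is, $w(a+b-x)=w(x)$ for $x\in[a,b]$, then $$u\left(\frac{a+b}{2}\right)\left[\mathcal{I}^{\alpha}_a w(b)+\mathcal{I}^{\alpha}_b w(a)\right]\leq \mathcal{I}^{\alpha}_a(uw)(b)+\mathcal{I}^{\alpha}_b(uw)(a)\leq \frac{u(a)+u(b)}{2}\left[\mathcal{I}^{\alpha}_a w(b)+\mathcal{I}^{\alpha}_b w(a)\right].$$
   Context: For $\alpha\in(0,1)$ and $f\in L_1(a,b)$, the fractional integrals with exponential kernel are defined by $$\mathcal{I}^\alpha_a f(x)=\frac{1}{\alpha}\int_a^x \exp\left(-\frac{1-\alpha}{\alpha}(x-s)\right)f(s)\,ds,\quad x>a,$$ $$\mathcal{I}^\alpha_b f(x)=\frac{1}{\alpha}\int_x^b \exp\left(-\frac{1-\alpha}{\alpha}(s-x)\right)f(s)\,ds,\quad x<b.$$ Here $uw$ denotes the pointwise product; $\mathcal{I}^\alpha_a f(b)$ is the first operator evaluated at $x=b$, and $\mathcal{I}^\alpha_b f(a)$ is the second evaluated at $x=a$. *)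

(* Defs.v *)
From HB Require Import structures.
From mathcomp Require Import all_boot all_order all_algebra.
From mathcomp Require Import all_classical all_reals all_analysis.

Set Implicit Arguments.
Unset Strict Implicit.
Unset Printing Implicit Defensive.

Import Order.TTheory GRing.Theory Num.Theory.
Import numFieldNormedType.Exports.

Local Open Scope classical_set_scope.
Local Open Scope ring_scope.

(* A function on [a, b] is a total function on R of which only the values on
   [a, b] matter. [lebesgue_measure] lives on the Borel sigma-algebra, so L_1
   (Lebesgue measurable functions) is taken with respect to its completion.
   [Rintegral] truncates infinite values to 0: the operators are meaningful
   only for f integrable on the integration interval. *)

Definition frac_int_left (R : realType) (alpha a : R) (f : R -> R) (x : R) : R :=
  alpha^-1 *
  \int[completed_lebesgue_measure]_(s in `[a, x])
    (expR (- ((1 - alpha) / alpha) * (x - s)) * f s).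

Definition frac_int_right (R : realType) (alpha b : R) (f : R -> R) (x : R) : R :=
  alpha^-1 *
  \int[completed_lebesgue_measure]_(s in `[x, b])
    (expR (- ((1 - alpha) / alpha) * (s - x)) * f s).

(* Main.v *)
(* The reflection s |-> a + b - s preserves the completed Lebesgue measure and
   exchanges the two kernels, so I_a f(b) + I_b f(a) = I_a (f + f o r)(b) where
   r is the reflection. By symmetry of w, for f = u w the integrand is
   (u + u o r) w and for f = w it is 2 w. Since w >= 0, both inequalities follow
   from the pointwise bounds 2 u((a + b) / 2) <= u + u o r <= u a + u b given by
   convexity. *)

Require Import Defs.
From HB Require Import structures.
From mathcomp Require Import all_boot all_order all_algebra.
From mathcomp Require Import all_classical all_reals all_analysis.
From mathcomp Require Import measurable_realfun ring lra.

Set Implicit Arguments.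
Unset Strict Implicit.
Unset Printing Implicit Defensive.

Import Order.TTheory GRing.Theory Num.Theory.
Import numFieldNormedType.Exports.

Local Open Scope classical_set_scope.
Local Open Scope ring_scope.

(** * Reflection invariance of Lebesgue measure and of its completion *)

Local Open Scope ereal_scope.

(** By uniqueness of Lebesgue measure, it suffices that the pushforward under the reflection gives
    half-open intervals their length. *)
Lemma lebesgue_measure_reflect (R : realType) (c : R) (A : set R) :
  measurable A -> lebesgue_measure [set x | A (c - x)%R] = lebesgue_measure A.
Proof.
move=> mA.
pose phi : measurableTypeR R -> measurableTypeR R := (fun x => c - x)%R.
have mphi : measurable_fun setT phi by exact: measurable_funB.
have := @lebesgue_measure_unique R (pushforward lebesgue_measure phi).
move=> /(_ mphi _ A mA) ->//= _ [[a b]] _ <-.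
(* The reflected interval is closed on the other side, which does not change its length. *)
rewrite /pushforward/= (_ : phi @^-1` _ = `[(c - b)%R, (c - a)%R[%classic).
  rewrite !lebesgue_measure_itv/= !lte_fin.
  rewrite ltrD2l ltrN2; case: ifP => // _.
  by rewrite -!EFinB; congr (_%:E); ring.
apply/seteqP; split => x; rewrite /= !in_itv/= /phi => /andP[h1 h2];
  apply/andP; split; lra.
Qed.

(* Outer measures are computed by Borel (G-delta) hulls, so invariance on Borel
   sets passes to all sets, in particular to the completed sigma-algebra. *)
Lemma outer_lebesgue_measure_reflect (R : realType) (c : R) (A : set R) :
  (wlength idfun)^*%mu [set x | A (c - x)%R] = (wlength idfun)^*%mu A.
Proof.
(* The reflection is an involution, so one inequality, applied to the reflected set, gives the
   converse. *)
wlog suff le_reflect : A / (wlength idfun)^*%mu [set x | A (c - x)%R] <=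
    (wlength idfun)^*%mu A.
  apply/eqP; rewrite eq_le; apply/andP; split; first exact: le_reflect.
  have := le_reflect [set x | A (c - x)%R].
  congr ((wlength idfun)^*%mu _ <= _).
  by apply/seteqP; split => x /=; rewrite subKr.
have [G [oG AG <-]] := outer_measure_Gdelta A.
have mG : measurable (\bigcap_i G i).
  by apply: bigcapT_measurable => i; exact: open_measurable.
rewrite -(lebesgue_measure_reflect c mG).
apply: le_outer_measure => x Ax; exact: AG.
Qed.

Section completed_lebesgue_reflection.
Context (R : realType) (c : R).

Notation clmu := (@completed_lebesgue_measure R).
Notation RL := (caratheodory_type (wlength (@idfun R))^*%mu).

Let phi : RL -> RL := fun x : R => (c - x)%R.

(** Caratheodory's criterion for the reflection of [A], tested on [X], is the criterion for [A]
    tested on the reflection of [X], since the outer measure is invariant. *)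
Let mphi : measurable_fun setT phi.
Proof.
move=> _ A mA; rewrite setTI; apply: le_caratheodory_measurable => /= X.
have reflectI B : X `&` [set x | B (c - x)%R] =
    [set x | ([set x | X (c - x)%R] `&` B) (c - x)%R].
  by apply/seteqP; split => x /=; rewrite subKr.
rewrite (reflectI A) (reflectI (~` A)) !outer_lebesgue_measure_reflect.
have /(_ [set x | X (c - x)%R]) <- :=
  mA : caratheodory_measurable (wlength idfun)^*%mu A.
by rewrite outer_lebesgue_measure_reflect.
Qed.

(** Change of variables: the pushforward of [clmu] by [phi] is [clmu] itself. *)
Lemma ge0_integral_reflect (D : set RL) (f : RL -> \bar R) :
  measurable D -> measurable_fun D f -> {in D, forall x, 0 <= f x} ->
  \int[clmu]_(x in D) f x = \int[clmu]_(x in phi @^-1` D) f (phi x).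
Proof.
move=> mD mf f0.
rewrite -[RHS](ge0_integral_pushforward mphi)//.
apply: eq_measure_integral => A mA _.
by symmetry; exact: outer_lebesgue_measure_reflect.
Qed.

Lemma measurable_fun_reflect (D : set RL) (f : RL -> \bar R) :
  measurable D -> measurable_fun D f ->
  measurable_fun (phi @^-1` D) (f \o phi).
Proof.
move=> mD mf; apply: (measurable_comp mD) => //.
  by move=> _ [x Dx <-].
exact: measurable_funTS mphi.
Qed.

Lemma integral_reflect (D : set RL) (f : RL -> \bar R) :
  measurable D -> measurable_fun D f ->
  \int[clmu]_(x in D) f x = \int[clmu]_(x in phi @^-1` D) f (phi x).
Proof.
move=> mD mf; rewrite [LHS]integralE [RHS]integralE.
rewrite (ge0_integral_reflect mD (measurable_funepos mf)); last first.
  by move=> x _; exact: funepos_ge0.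
rewrite (ge0_integral_reflect mD (measurable_funeneg mf)); last first.
  by move=> x _; exact: funeneg_ge0.
by congr (_ - _); apply: eq_integral => x _; rewrite ?funeposE ?funenegE.
Qed.

Lemma integrable_reflect (D : set RL) (f : RL -> \bar R) :
  measurable D -> clmu.-integrable D f ->
  clmu.-integrable (phi @^-1` D) (f \o phi).
Proof.
move=> mD /integrableP[mf foo]; apply/integrableP; split.
  exact: measurable_fun_reflect.
have mabsf : measurable_fun D (abse \o f) by exact: measurableT_comp.
by rewrite -(ge0_integral_reflect mD mabsf)// => x _; exact: abse_ge0.
Qed.

End completed_lebesgue_reflection.

Local Close Scope ereal_scope.

(** * Reflection of an interval about its midpoint *)

Section completed_lebesgue_interval.
Context (R : realType) (a b : R).

Notation clmu := (@completed_lebesgue_measure R).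
Notation RL := (caratheodory_type (wlength (@idfun R))^*%mu).

Lemma measurable_caratheodory_itv : measurable (`[a, b]%classic : set RL).
Proof. by apply: sub_caratheodory; exact: measurable_itv. Qed.

(** The Caratheodory sigma-algebra contains the Borel one; this serves for the exponential
    kernels. *)
Lemma measurable_fun_caratheodory (D : set RL) (f : R -> R) :
  measurable_fun setT f -> measurable_fun D (f : RL -> R).
Proof.
move=> mf; apply: measurable_funTS => _ A mA; apply: sub_caratheodory.
exact: mf.
Qed.

Lemma reflect_itv :
  (fun x : R => a + b - x) @^-1` `[a, b]%classic = `[a, b]%classic.
Proof.
by apply/seteqP; split => x; rewrite /= !in_itv/= => /andP[? ?];
  apply/andP; split; lra.
Qed.

Lemma integrable_reflect_itv (f : R -> R) :
  clmu.-integrable `[a, b] (EFin \o f) ->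
  clmu.-integrable `[a, b] (EFin \o (fun x => f (a + b - x))).
Proof.
move=> /(integrable_reflect (a + b) measurable_caratheodory_itv).
by rewrite reflect_itv.
Qed.

Lemma Rintegral_reflect_itv (f : R -> R) :
  measurable_fun (`[a, b]%classic : set RL) (f : RL -> R) ->
  \int[clmu]_(x in `[a, b]) f x = \int[clmu]_(x in `[a, b]) f (a + b - x).
Proof.
move=> mf; rewrite /Rintegral; congr fine.
rewrite (integral_reflect (a + b) measurable_caratheodory_itv).
  by rewrite reflect_itv.
exact/measurable_EFinP.
Qed.

End completed_lebesgue_interval.

(** * Linearity, monotonicity and reflection of the fractional integrals *)

Section frac_int_theory.
Context (R : realType) (alpha a b : R).
Hypotheses (alpha_gt0 : 0 < alpha) (alpha_lt1 : alpha < 1).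

Notation clmu := (@completed_lebesgue_measure R).
Notation RL := (caratheodory_type (wlength (@idfun R))^*%mu).

Let k := (1 - alpha) / alpha.

Let k_ge0 : 0 <= k.
Proof. by rewrite divr_ge0 ?subr_ge0 ?ltW. Qed.

(** The kernel is measurable and bounded on [[a, b]], so multiplying by it preserves
    integrability. *)
Lemma integrable_frac_int_left (f : R -> R) :
  clmu.-integrable `[a, b] (EFin \o f) ->
  clmu.-integrable `[a, b] (EFin \o (fun s => expR (- k * (b - s)) * f s)).
Proof.
move=> intf; pose h s := expR (- k * (b - s)).
have mh : measurable_fun (`[a, b]%classic : set RL) (h : RL -> R).
  apply: measurable_fun_caratheodory; apply: measurableT_comp => //.
  by apply: measurable_funM => //; exact: measurable_funB.
have bh : [bounded h x | x in (`[a, b]%classic : set RL)].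
  (* The bound is 1: the exponent is nonpositive because [k >= 0] and [s <= b]. *)
  exists 1; split => // M M1 s /=; rewrite in_itv/= => /andP[_ sb].
  rewrite (le_trans _ (ltW M1))// ger0_norm ?expR_ge0//.
  by rewrite -expR0 ler_expR mulNr oppr_le0 mulr_ge0// subr_ge0.
have := integrableMl (measurable_caratheodory_itv a b) intf mh bh.
by apply: eq_integrable => [|s _]; [exact: measurable_caratheodory_itv|
  rewrite /= -EFinM mulrC].
Qed.

Lemma frac_int_leftZ (c : R) (f : R -> R) :
  clmu.-integrable `[a, b] (EFin \o f) ->
  frac_int_left alpha a (fun s => c * f s) b = c * frac_int_left alpha a f b.
Proof.
move=> /integrable_frac_int_left intf; rewrite /frac_int_left mulrCA.
rewrite -(RintegralZl _ (measurable_caratheodory_itv a b) intf).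
by congr (_ * _); apply: eq_Rintegral => s _; rewrite mulrCA.
Qed.

Lemma frac_int_leftD (f g : R -> R) :
  clmu.-integrable `[a, b] (EFin \o f) -> clmu.-integrable `[a, b] (EFin \o g) ->
  frac_int_left alpha a (fun s => f s + g s) b =
  frac_int_left alpha a f b + frac_int_left alpha a g b.
Proof.
move=> /integrable_frac_int_left intf /integrable_frac_int_left intg.
rewrite /frac_int_left -mulrDr.
rewrite -(RintegralD (measurable_caratheodory_itv a b) intf intg).
by congr (_ * _); apply: eq_Rintegral => s _; rewrite mulrDr.
Qed.

Lemma le_frac_int_left (f g : R -> R) :
  clmu.-integrable `[a, b] (EFin \o f) -> clmu.-integrable `[a, b] (EFin \o g) ->
  (forall s, s \in `[a, b] -> f s <= g s) ->
  frac_int_left alpha a f b <= frac_int_left alpha a g b.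
Proof.
move=> /integrable_frac_int_left intf /integrable_frac_int_left intg fg.
rewrite ler_pM2l ?invr_gt0//.
apply: (le_Rintegral (measurable_caratheodory_itv a b) intf intg) => s sab.
by rewrite ler_pM2l ?expR_gt0// fg.
Qed.

(** Under the reflection, the distance [s - a] in the right kernel becomes [b - s], the one in the
    left kernel. *)
Lemma frac_int_right_reflect (f : R -> R) :
  clmu.-integrable `[a, b] (EFin \o f) ->
  frac_int_right alpha b f a = frac_int_left alpha a (fun s => f (a + b - s)) b.
Proof.
move=> intf; rewrite /frac_int_right /frac_int_left; congr (_ * _).
rewrite Rintegral_reflect_itv.
  by apply: eq_Rintegral => s _; congr (expR (_ * _) * _); ring.
have /measurable_EFinP mf := measurable_int _ intf.
apply: measurable_funM => //.
apply: measurable_fun_caratheodory; apply: measurableT_comp => //.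
by apply: measurable_funM => //; exact: measurable_funB.
Qed.

End frac_int_theory.

(** * Pointwise bounds for convex functions *)

Section convex_on_interval.
Context (R : realType) (a b : R) (u : R -> R).
Hypotheses (ab : a < b) (cu : convex_function (`[a, b]%classic : set R) u).

Let itv_convex_coeff s : s \in `[a, b] ->
  exists t, [/\ 0 <= t, t <= 1 & s = t * a + (1 - t) * b].
Proof.
rewrite in_itv/= => /andP[as_ sb].
have ba0 : 0 < b - a by rewrite subr_gt0.
exists ((b - s) / (b - a)); split; last by field; rewrite gt_eqF.
  by rewrite divr_ge0 ?subr_ge0// ltW.
by rewrite ler_pdivrMr// mul1r lerD2l lerN2.
Qed.

Let convex_le x y t : x \in `[a, b] -> y \in `[a, b] -> 0 <= t -> t <= 1 ->
  u (t * x + (1 - t) * y) <= t * u x + (1 - t) * u y.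
Proof.
move=> xab yab t0 t1; have := @cu (Itv01 t0 t1) x y.
by rewrite !inE/= => /(_ xab yab); rewrite !convRE.
Qed.

Let convex_le_chord t : 0 <= t -> t <= 1 ->
  u (t * a + (1 - t) * b) <= t * u a + (1 - t) * u b.
Proof. by apply: convex_le; rewrite in_itv/= lexx ltW. Qed.

(** The midpoint of [[a, b]] is also the midpoint of [s] and its reflection. *)
Lemma convex_midpoint_le s : s \in `[a, b] ->
  2 * u ((a + b) / 2) <= u s + u (a + b - s).
Proof.
move=> sab.
have rsab : a + b - s \in `[a, b].
  by move: sab; rewrite !in_itv/= => /andP[? ?]; apply/andP; split; lra.
have h0 : 0 <= 2^-1 :> R by rewrite invr_ge0.
have h1 : 2^-1 <= 1 :> R by rewrite invf_le1// ler1n.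
have := convex_le sab rsab h0 h1.
rewrite (_ : _ + _ * (a + b - s) = (a + b) / 2); last by field.
by rewrite -(ler_pM2l (ltr0Sn R 1)) => /le_trans; apply; lra.
Qed.

(** Reflecting swaps the barycentric weights [t] and [1 - t] of [a] and [b], so the two chord bounds
    add up to [u a + u b]. *)
Lemma convex_endpoints_ge s : s \in `[a, b] -> u s + u (a + b - s) <= u a + u b.
Proof.
move=> /itv_convex_coeff[t [t0 t1 ->]].
have t0' : 0 <= 1 - t by lra.
have t1' : 1 - t <= 1 by lra.
have := lerD (convex_le_chord t0 t1) (convex_le_chord t0' t1').
rewrite (_ : (1 - t) * a + _ = a + b - (t * a + (1 - t) * b)); last by ring.
by move/le_trans; apply; lra.
Qed.

(** The chord bounds [u] above; the midpoint inequality then bounds [u s] below by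
    [2 * u ((a + b) / 2) - u (a + b - s)]. This is used to integrate [u \* w]. *)
Lemma convex_bounded_itv : exists M, forall s, s \in `[a, b] -> `|u s| <= M.
Proof.
have u_le s : s \in `[a, b] -> u s <= `|u a| + `|u b|.
  move=> /itv_convex_coeff[t [t0 t1 ->]].
  have := convex_le_chord t0 t1.
  have := ler_norm (u a); have := ler_norm (u b).
  by have := normr_ge0 (u a); have := normr_ge0 (u b); nra.
exists (`|u a| + `|u b| + 2 * `|u ((a + b) / 2)|) => s sab.
have rsab : a + b - s \in `[a, b].
  by move: sab; rewrite !in_itv/= => /andP[? ?]; apply/andP; split; lra.
have := convex_midpoint_le sab; have := u_le _ sab; have := u_le _ rsab.
have := ler_norm (- u ((a + b) / 2)); rewrite normrN ler_norml.
by have := normr_ge0 (u ((a + b) / 2)) => *; apply/andP; split; lra.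
Qed.

End convex_on_interval.

Theorem theorem4p1 (R : realType) (a b alpha : R) (u w : R -> R)
  (hab : a < b)
  (halpha0 : 0 < alpha) (halpha1 : alpha < 1)
  (hu_convex : convex_function (`[a, b]%classic : set R) u)
  (hu_int : completed_lebesgue_measure.-integrable `[a, b] (EFin \o u))
  (hw_ge0 : forall x, x \in `[a, b] -> 0 <= w x)
  (hw_int : completed_lebesgue_measure.-integrable `[a, b] (EFin \o w))
  (hw_sym : forall x, x \in `[a, b] -> w (a + b - x) = w x) :
  u ((a + b) / 2) * (frac_int_left alpha a w b + frac_int_right alpha b w a)
    <= frac_int_left alpha a (u \* w) b + frac_int_right alpha b (u \* w) a
  /\
  frac_int_left alpha a (u \* w) b + frac_int_right alpha b (u \* w) a
    <= (u a + u b) / 2 *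
       (frac_int_left alpha a w b + frac_int_right alpha b w a).
Proof.
have [M uM] := convex_bounded_itv hab hu_convex.
(* A product of integrable functions may fail to be integrable; here [u] is moreover bounded, by
   convexity. *)
have huw_int : completed_lebesgue_measure.-integrable `[a, b]
    (EFin \o (u \* w)).
  have /measurable_EFinP mu := measurable_int _ hu_int.
  have bu : [bounded u x | x in (`[a, b]%classic : set
      (caratheodory_type (wlength (@idfun R))^*%mu))].
    exists M; split; [exact: num_real|move=> N MN s sab].
    exact: (le_trans (uM s sab) (ltW MN)).
  have := integrableMl (measurable_caratheodory_itv a b) hw_int mu bu.
  by apply: eq_integrable => [|s _]; [exact: measurable_caratheodory_itv|
    rewrite /= -EFinM mulrC].
have huwr_int := integrable_reflect_itv huw_int.
(* Since [w] is its own reflection, both operators agree on it and the bracket is twice the left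
   one. *)
have -> : frac_int_right alpha b w a = frac_int_left alpha a w b.
  rewrite frac_int_right_reflect//; congr (_ * _).
  by apply: eq_Rintegral => s /set_mem sab; rewrite hw_sym.
rewrite (frac_int_right_reflect _ huw_int)//.
rewrite -(frac_int_leftD _ _ huw_int huwr_int)//.
have sumE c :
    c * frac_int_left alpha a w b = frac_int_left alpha a (fun s => c * w s) b.
  by rewrite frac_int_leftZ.
have hcw_int c : completed_lebesgue_measure.-integrable `[a, b]
    (EFin \o (fun s => c * w s)).
  have := integrableZl (measurable_caratheodory_itv a b) c hw_int.
  by apply: eq_integrable => //; exact: measurable_caratheodory_itv.
have hsum_int : completed_lebesgue_measure.-integrable `[a, b]
    (EFin \o (fun s => (u \* w) s + (u \* w) (a + b - s))).
  have := integrableD (measurable_caratheodory_itv a b) huw_int huwr_int.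
  by apply: eq_integrable => //; exact: measurable_caratheodory_itv.
have uwE s : s \in `[a, b] ->
    (u \* w) s + (u \* w) (a + b - s) = (u s + u (a + b - s)) * w s.
  by move=> sab; rewrite /= hw_sym// mulrDl.
split.
  (* The constant is moved inside the operator, so that monotonicity leaves a pointwise inequality
     between multiples of [w s]. *)
  rewrite (_ : _ * (_ + _) = 2 * u ((a + b) / 2) * frac_int_left alpha a w b);
    last by ring.
  rewrite sumE; apply: le_frac_int_left => // s sab.
  rewrite uwE// ler_wpM2r ?hw_ge0//; exact: convex_midpoint_le.
rewrite (_ : _ * (_ + _) = (u a + u b) * frac_int_left alpha a w b);
  last by field.
rewrite sumE; apply: le_frac_int_left => // s sab.
rewrite uwE// ler_wpM2r ?hw_ge0//; exact: convex_endpoints_ge.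
Qed.
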